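(* Let $(X_t)_{t\in[0,1]}$ be a centered process as in the context, with KL expansion $X_t=\sum_{k\ge1}Z_ke_k(t)$, and assume that the coefficients $(Z_k)_{k\ge1}$ are mutually independent and that each $Z_k$ is sub-Gaussian with mean $0$ and parameter $\sqrt{\lambda_k}$. Let $c_g\in\mathbb R$, $K_g\ge0$, and for each $t\in[0,1]$ let $g_t:\mathbb R\to\mathbb R$ satisfy $g_t(x)-g_t(y)\le\max\big(|e^{c_gx}-e^{c_gy}|,\,K_g|x-y|\big)$ for all $x,y$ (the same constants for all $t$). Define $S_t=g_t(X_t)$ and, for $\epsilon>0$, $X'_t=\sum_{k=1}^{L_X(\epsilon)}Z_ke_k(t)$ and $S'_t=g_t(X'_t)$. Then there is a constant $C_2$, independent of $t$ and $\epsilon$, such that $$\mathbb E\big[(S_t-S'_t)^2\big]\le C_2\epsilon^2\qquad\text{for all }t\in[0,1]\text{ and all }\epsilon\in(0,1].$$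
   Context: Standing setup: $(X_t)_{t\in[0,1]}$ is a centered stochastic process with $\mathbb E[X_t^2]<\infty$ whose covariance $k_X(s,t)=\mathbb E[X_sX_t]$ is continuous on $[0,1]^2$. Let $\mathcal K$ be the integral operator $(\mathcal Kf)(t)=\int_0^1k_X(s,t)f(s)\,ds$ on $L^2([0,1])$, with orthonormal eigenfunctions $(e_k)_{k\ge1}$ and eigenvalues $\lambda_1\ge\lambda_2\ge\dots\ge0$. The Karhunen–Loève (KL) expansion is $X_t=\sum_{k\ge1}Z_ke_k(t)$ with $Z_k=\int_0^1X_te_k(t)\,dt$, converging in $L^2(\mathbb P)$ uniformly in $t$; the $Z_k$ are centered and uncorrelated with $\mathbb E[Z_k^2]=\lambda_k$. The truncation index $L_X(\epsilon)$ is the smallest natural number $L$ such that $\mathbb E\big[(\sum_{k=1}^{L}Z_ke_k(t)-X_t)^2\big]\le\epsilon^2$ for all $t\in[0,1]$. A real random variable $W$ with mean $m$ is sub-Gaussian with parameter $s\ge0$ if $\mathbb E[\exp(\theta(W-m))]\le\exp(\theta^2s^2/2)$ for all $\theta\in\mathbb R$. *)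

(* Defs.v *)
From HB Require Import structures.
From mathcomp Require Import all_boot all_order all_algebra.
From mathcomp Require Import all_classical all_reals all_analysis.
Set Implicit Arguments. Unset Strict Implicit. Unset Printing Implicit Defensive.
Import Order.TTheory GRing.Theory Num.Theory.
Import numFieldNormedType.Exports.
Local Open Scope classical_set_scope.
Local Open Scope ring_scope.

Definition I01 {R : realType} : set R := `[0%R, 1%R].

Definition mutually_independent {R : realType} {d : measure_display}
  {T : measurableType d} (P : probability T R) (Z : nat -> T -> R) : Prop :=
  (forall k, measurable_fun setT (Z k)) /\
  forall (J : seq nat) (B : nat -> set R),
    uniq J -> (forall k, measurable (B k)) ->
    P (\bigcap_(k in [set k | k \in J]) (Z k @^-1` B k)) =
    (\prod_(k <- J) P (Z k @^-1` B k))%E.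

Definition subgaussian {R : realType} {d : measure_display}
  {T : measurableType d} (P : probability T R) (W : T -> R) (m s : R) : Prop :=
  0 <= s /\ P.-integrable setT (fun w => (W w)%:E) /\
  (\int[P]_w (W w)%:E = m%:E)%E /\
  forall theta : R,
    (\int[P]_w (expR (theta * (W w - m)))%:E <= (expR (theta ^+ 2 * s ^+ 2 / 2))%:E)%E.

Definition covX {R : realType} {d : measure_display}
  {T : measurableType d} (P : probability T R) (X : R -> T -> R) (s t : R) : R :=
  fine (\int[P]_w (X s w * X t w)%:E)%E.

(* Truncated KL expansion  sum_{k=1}^{L} Z_k e_k(t)  (0-based indexing:
   paper's Z_{k+1}, e_{k+1} are Z k, e k here). *)
Definition KLtrunc {R : realType} {T : Type} (Z : nat -> T -> R)
  (e : nat -> R -> R) (L : nat) (t : R) (w : T) : R :=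
  \sum_(k < L) Z k w * e k t.

Definition trunc_err {R : realType} {d : measure_display}
  {T : measurableType d} (P : probability T R) (X : R -> T -> R)
  (Z : nat -> T -> R) (e : nat -> R -> R) (L : nat) (t : R) : \bar R :=
  (\int[P]_w ((KLtrunc Z e L t w - X t w) ^+ 2)%:E)%E.

Definition is_trunc_index {R : realType} {d : measure_display}
  {T : measurableType d} (P : probability T R) (X : R -> T -> R)
  (Z : nat -> T -> R) (e : nat -> R -> R) (eps : R) (L : nat) : Prop :=
  (forall t, I01 t -> (trunc_err P X Z e L t <= (eps ^+ 2)%:E)%E) /\
  forall L', (forall t, I01 t -> (trunc_err P X Z e L' t <= (eps ^+ 2)%:E)%E) ->
    (L <= L')%N.

(* Main.v *)
(* Write [D] for the residual [X_t - X'_t].  Independence multiplies the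
   sub-Gaussian bounds of the coefficients, and the partial sums converge to
   [X_t] in mean square, so [X_t], [X'_t] and [D] have moment generating
   functions bounded by [exp (2 theta^2 v)], with [v] a bound on [E X_t^2] for
   the first two (uniform in [t], since the covariance is continuous on a
   compact set) and [v = eps^2] for [D].  In particular [E D^4] is
   [O(eps^4)].  Finally
   [(e^(cx) - e^(cy))^2 <= 2 c^2 (x - y)^2 (e^(2cx) + e^(2cy))], and weighting
   AM-GM by [eps] splits the product into
   [eps^2 * ((D / eps)^4 + e^(4cx) + e^(4cy))], whose expectation is
   [O(eps^2)]. *)
Require Import Defs.
From HB Require Import structures.
From mathcomp Require Import all_boot all_order all_algebra.
From mathcomp Require Import all_classical all_reals all_analysis.
From mathcomp Require Import measurable_realfun lra ring.
Import Order.TTheory GRing.Theory Num.Theory.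
Import numFieldNormedType.Exports.
Local Open Scope classical_set_scope.
Local Open Scope ring_scope.

Set Implicit Arguments.
Unset Strict Implicit.

(** * Expectations of products of functions of independent variables *)

Section independence.
Import HBNNSimple.
Context {R : realType} {d : measure_display} {T : measurableType d}.
Variable P : probability T R.

(** The assumption on [B] is the case where [h] is an indicator. Linearity extends it to simple
    functions and monotone convergence to all nonnegative measurable [h]. In use, [W] collects the
    other factors of a product and [c] is their expectation. *)
Lemma ge0_integral_comp_mul (Y W : T -> R) (c : R) (h : R -> R) :
  measurable_fun setT Y -> measurable_fun setT W -> (forall w, 0 <= W w) ->
  0 <= c ->
  (forall B, measurable B ->
    (\int[P]_w (\1_B (Y w) * W w)%:E = c%:E * P (Y @^-1` B))%E) ->
  measurable_fun setT h -> (forall x, 0 <= h x) ->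
  (\int[P]_w (h (Y w) * W w)%:E = c%:E * \int[P]_w (h (Y w))%:E)%E.
Proof.
move=> mY mW W0 c0 HB mh h0.
have simple (f : {nnsfun R >-> R}) :
    (\int[P]_w (f (Y w) * W w)%:E = c%:E * \int[P]_w (f (Y w))%:E)%E.
  pose ind (y : R) (x : R) : R := \1_(f @^-1` [set y]) x.
  (* The absolute value changes nothing on the range of [f], but it makes every coefficient
     nonnegative for all [y], so the sum can leave the integral without any integrability
     argument. *)
  have [s fE] : exists s, forall x, f x = \sum_(y <- s) `|y| * ind y x.
    exists (finmap.enum_fset (fset_set (range f))) => x.
    rewrite fimfunE fsbig_finite//=; apply: eq_big_seq => y.
    rewrite /= in_fset_set// inE => -[z _ <-].
    by rewrite ger0_norm.
  have mpre y : measurable (f @^-1` [set y]) by exact: measurable_funPTI.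
  have mind y : measurable_fun setT (fun w => ind y (Y w)).
    by apply: measurableT_comp => //; exact: measurable_indic.
  have ind0 y x : 0 <= ind y x by rewrite /ind indicE.
  under eq_integral do rewrite fE mulr_suml -sumEFin.
  under [in RHS]eq_integral do rewrite fE -sumEFin.
  rewrite ge0_integral_sum//; last first.
    - by move=> y w _; rewrite lee_fin mulr_ge0// mulr_ge0.
    - move=> y; apply/measurable_EFinP; apply: measurable_funM => //.
      exact: measurable_funM.
  rewrite ge0_integral_sum//; last first.
    - by move=> y w _; rewrite lee_fin mulr_ge0.
    - by move=> y; apply/measurable_EFinP; exact: measurable_funM.
  rewrite ge0_sume_distrr; last first.
    by move=> y _; apply: integral_ge0 => w _; rewrite lee_fin mulr_ge0.
  apply: eq_bigr => y _.
  under eq_integral do rewrite -mulrA EFinM.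
  under [in RHS]eq_integral do rewrite EFinM.
  rewrite !ge0_integralZl_EFin//; last first.
    - by apply/measurable_EFinP; exact: measurable_funM.
    - by move=> w _; rewrite lee_fin mulr_ge0.
    - by apply/measurable_EFinP.
    - by move=> w _; rewrite lee_fin.
  rewrite HB// muleCA; congr (_ * (_ * _))%E.
  rewrite -[in LHS](setIT (Y @^-1` _)) -integral_indic//.
  by rewrite -[X in measurable X]setTI; exact: mY.
have mEh : measurable_fun [set: R] (EFin \o h) by exact/measurable_EFinP.
pose f := nnsfun_approx measurableT mEh.
have cvgf x : f n x @[n --> \oo] --> h x.
  exact: (fine_cvg (@cvg_nnsfun_approx _ _ _ _ measurableT _ mEh
    (fun x _ => h0 x) x Logic.I)).
have ndf : nondecreasing_seq (f : (R -> R)^nat) by exact: nd_nnsfun_approx.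
have mf n : measurable_fun setT (fun w => f n (Y w)).
  exact: measurableT_comp.
have cvg1 : (\int[P]_w (f n (Y w) * W w)%:E)%E @[n --> \oo] -->
            (\int[P]_w (h (Y w) * W w)%:E)%E.
  rewrite [X in _ --> X](_ : _ =
      (\int[P]_w limn (fun n => (f n (Y w) * W w)%:E))%E); last first.
    apply: eq_integral => w _; apply/esym/cvg_lim => //.
    by apply: cvg_EFin; [near=> n|apply: cvgM => //; exact: cvg_cst].
  apply: cvg_monotone_convergence => //.
  - by move=> n; apply/measurable_EFinP; exact: measurable_funM.
  - by move=> n w _; rewrite lee_fin mulr_ge0.
  - move=> w _ m n mn; rewrite lee_fin ler_wpM2r//.
    by have /lefP := ndf _ _ mn; apply.
have cvg2 : (\int[P]_w (f n (Y w))%:E)%E @[n --> \oo] -->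
            (\int[P]_w (h (Y w))%:E)%E.
  rewrite [X in _ --> X](_ : _ =
      (\int[P]_w limn (fun n => (f n (Y w))%:E))%E); last first.
    apply: eq_integral => w _; apply/esym/cvg_lim => //.
    by apply: cvg_EFin; [near=> n|exact: cvgf].
  apply: cvg_monotone_convergence => //.
  - by move=> n; apply/measurable_EFinP.
  - by move=> n w _; rewrite lee_fin.
  - move=> w _ m n mn; rewrite lee_fin.
    by have /lefP := ndf _ _ mn; apply.
apply/esym; rewrite -(cvg_lim _ cvg1)//; apply/esym/cvg_lim => //.
under eq_cvg do rewrite simple.
exact: cvgeZl.
Unshelve. all: by end_near. Qed.

(** Independence is given for events only; [ge0_integral_comp_mul] upgrades one indicator at a time
    to a function. Finiteness of the expectations makes the constant passed to that lemma a real
    number. *)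
Lemma mutually_independent_integral_prod (Z : nat -> T -> R) (h : nat -> R -> R)
    (J : seq nat) :
  mutually_independent P Z -> uniq J ->
  (forall k, measurable_fun setT (h k)) -> (forall k x, 0 <= h k x) ->
  (forall k, \int[P]_w (h k (Z k w))%:E < +oo)%E ->
  (\int[P]_w (\prod_(k <- J) h k (Z k w))%:E =
   \prod_(k <- J) \int[P]_w (h k (Z k w))%:E)%E.
Proof.
move=> [mZ indep] uJ mh h0 hoo.
have mind B : measurable B -> measurable_fun [set: R] (\1_B : R -> R).
  by move=> mB; exact: measurable_indic.
have mpre k B : measurable B -> measurable (Z k @^-1` B).
  by move=> mB; rewrite -[X in measurable X]setTI; exact: mZ.
(* The indicators indexed by J1 are traded for the functions indexed by J2. *)
suff mixed (J2 J1 : seq nat) (B : nat -> set R) :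
    uniq (J1 ++ J2) -> (forall k, measurable (B k)) ->
    (\int[P]_w (\prod_(k <- J1) \1_(B k) (Z k w) *
                \prod_(k <- J2) h k (Z k w))%:E =
     \prod_(k <- J1) P (Z k @^-1` B k) *
     \prod_(k <- J2) \int[P]_w (h k (Z k w))%:E)%E.
  have := mixed J [::] (fun=> setT) uJ (fun=> measurableT).
  rewrite big_nil mul1e => <-; apply: eq_integral => w _.
  by rewrite big_nil mul1r.
elim: J2 J1 B => [|j J2 IH] J1 B uJ12 mB.
  (* With no function left, the product of indicators is the indicator of the intersection, and the
     claim is independence of events. *)
  rewrite cats0 in uJ12; rewrite big_nil mule1 -indep//.
  rewrite -[X in P X]setIT -integral_indic//; last first.
    by apply: bigcap_measurableType => k _; exact: mpre.
  apply: eq_integral => w _; rewrite big_nil mulr1; congr EFin.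
  elim: J1 {uJ12} => [|j J1 IH1].
    by rewrite big_nil indicE mem_set// => k /=; rewrite in_nil.
  rewrite big_cons IH1 !indicE -natrM mulnb; congr (nat_of_bool _)%:R.
  apply/andP/idP => [[/set_mem Bj /set_mem BJ]|/set_mem BJ].
    apply/mem_set => k /=; rewrite inE => /orP[/eqP -> //|kJ].
    exact: BJ.
  split; apply/mem_set; first by apply: (BJ j); rewrite /= inE eqxx.
  by move=> k /= kJ; apply: BJ; rewrite /= inE kJ orbT.
have jJ1 : j \notin J1.
  by move: uJ12; rewrite cat_uniq /= negb_or => /and3P[_ /andP[]].
pose W w : R := \prod_(k <- J1) \1_(B k) (Z k w) * \prod_(k <- J2) h k (Z k w).
pose c : \bar R := (\prod_(k <- J1) P (Z k @^-1` B k) *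
     \prod_(k <- J2) \int[P]_w (h k (Z k w))%:E)%E.
have int0 k : (0 <= \int[P]_w (h k (Z k w))%:E)%E.
  by apply: integral_ge0 => w _; rewrite lee_fin.
have c0 : (0 <= c)%E by rewrite /c mule_ge0// prode_ge0.
have cfin : c \is a fin_num.
  rewrite /c fin_numM//; apply: prode_fin_num => k _.
    by rewrite fin_num_measure//; exact: mpre.
  by rewrite ge0_fin_numE.
have -> : (\prod_(k <- J1) P (Z k @^-1` B k) *
     \prod_(k <- j :: J2) \int[P]_w (h k (Z k w))%:E =
     (fine c)%:E * \int[P]_w (h j (Z j w))%:E)%E.
  by rewrite fineK// big_cons muleCA muleC.
rewrite -(ge0_integral_comp_mul (W := W))//.
- by apply: eq_integral => w _; rewrite big_cons /W mulrCA.
- apply: measurable_funM.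
    by apply: measurable_prod => k _; exact: measurableT_comp.
  by apply: measurable_prod => k _; exact: measurableT_comp.
- by move=> w; rewrite /W mulr_ge0// prodr_ge0.
- exact: fine_ge0.
- move=> A mA; rewrite fineK//.
  (* The event that [Z j] lies in [A] becomes one more indicator, so the induction hypothesis
     applies to [j :: J1]. Since [j] is not in [J1], the other indicators keep their sets. *)
  pose B' k := if k == j then A else B k.
  have B'j : B' j = A by rewrite /B' eqxx.
  have B'J k : k \in J1 -> B' k = B k.
    by move=> kJ; rewrite /B'; case: eqP => // kj; rewrite -kj kJ in jJ1.
  have := IH (j :: J1) B' _ _.
  rewrite !big_cons (eq_big_seq (fun k => P (Z k @^-1` B k))); last first.
    by move=> k kJ; rewrite B'J.
  rewrite B'j -muleA muleC -/c => <-.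
  + apply: eq_integral => w _.
    rewrite big_cons B'j /W mulrA.
    by congr (_ * _ * _)%:E; apply: eq_big_seq => k kJ; rewrite B'J.
  + by move: uJ12; rewrite -cat1s uniq_catCA.
  + by move=> k; rewrite /B'; case: ifP.
Qed.

End independence.

(** * Exponential and quadratic moments of finite sums and of their limits *)

Section moments.
Context {R : realType} {d : measure_display} {T : measurableType d}.
Variable P : probability T R.

(** The common tool for integrating a pointwise bound: since all functions are nonnegative,
    measurability suffices and integrability never has to be checked. *)
Lemma integral_le_comb2 (f g h : T -> R) (a b A B : R) :
  measurable_fun setT f -> measurable_fun setT g -> measurable_fun setT h ->
  (forall w, 0 <= f w) -> (forall w, 0 <= g w) -> (forall w, 0 <= h w) ->
  0 <= a -> 0 <= b -> (forall w, f w <= a * g w + b * h w) ->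
  (\int[P]_w (g w)%:E <= A%:E)%E -> (\int[P]_w (h w)%:E <= B%:E)%E ->
  (\int[P]_w (f w)%:E <= (a * A + b * B)%:E)%E.
Proof.
move=> mf mg mh f0 g0 h0 a0 b0 fgh gA hB.
apply: (@le_trans _ _ (\int[P]_w (a%:E * (g w)%:E + b%:E * (h w)%:E))%E).
  apply: ge0_le_integral => //.
  - by move=> w _; rewrite lee_fin.
  - exact/measurable_EFinP.
  - apply/measurable_EFinP; apply: measurable_funD; exact: measurable_funM.
  - by move=> w _; rewrite -!EFinM -EFinD lee_fin.
rewrite ge0_integralD//.
- rewrite !ge0_integralZl_EFin//.
  + by rewrite EFinD !EFinM leeD// lee_wpmul2l// lee_fin.
  + by move=> w _; rewrite lee_fin.
  + exact/measurable_EFinP.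
  + by move=> w _; rewrite lee_fin.
  + exact/measurable_EFinP.
- by move=> w _; rewrite -EFinM lee_fin mulr_ge0.
- by apply/measurable_EFinP; exact: measurable_funM.
- by move=> w _; rewrite -EFinM lee_fin mulr_ge0.
- by apply/measurable_EFinP; exact: measurable_funM.
Qed.

(** The exponential of the sum is a product of functions of the single [Z k]. Independence factors
    its expectation, and each factor is bounded by the sub-Gaussian property at [theta * a k]. *)
Lemma integral_expR_sum_le (Z : nat -> T -> R) (lam a : nat -> R)
    (J : seq nat) (theta : R) :
  mutually_independent P Z -> (forall k, 0 <= lam k) ->
  (forall k, subgaussian P (Z k) 0 (Num.sqrt (lam k))) -> uniq J ->
  (\int[P]_w (expR (theta * \sum_(k <- J) Z k w * a k))%:E <=
    (expR (theta ^+ 2 / 2 * \sum_(k <- J) lam k * a k ^+ 2))%:E)%E.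
Proof.
move=> indep lam0 subg uJ.
pose h k x : R := expR ((theta * a k) * x).
have hle k : (\int[P]_w (h k (Z k w))%:E <=
    (expR (theta ^+ 2 / 2 * (lam k * a k ^+ 2)))%:E)%E.
  have [_ [_ [_ /(_ (theta * a k))]]] := subg k.
  rewrite sqr_sqrtr// (_ : _ * lam k / 2 =
    theta ^+ 2 / 2 * (lam k * a k ^+ 2)); last by field.
  by under eq_integral do rewrite subr0.
under eq_integral.
  move=> w _; rewrite (_ : expR _ = \prod_(k <- J) h k (Z k w)); last first.
    rewrite -expR_sum mulr_sumr; congr expR; apply: eq_bigr => k _.
    by rewrite (mulrC (Z k w)) mulrA.
  over.
rewrite mutually_independent_integral_prod//.
- rewrite mulr_sumr expR_sum.
  elim: J {uJ} => [|j J IH]; first by rewrite !big_nil.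
  rewrite !big_cons EFinM lee_pmul//.
    by apply: integral_ge0 => w _; rewrite lee_fin expR_ge0.
  apply: prode_ge0 => k _.
  by apply: integral_ge0 => w _; rewrite lee_fin expR_ge0.
- move=> k; apply: measurableT_comp => //; exact: measurable_funM.
- by move=> k x; exact: expR_ge0.
- by move=> k; apply: le_lt_trans (hle k) _; rewrite ltry.
Qed.

Lemma integral_sqr_sum (Z : nat -> T -> R) (lam a : nat -> R) (J : seq nat) :
  (forall k, measurable_fun setT (Z k)) ->
  (forall i j, (\int[P]_w (Z i w * Z j w)%:E)%E =
    (if i == j then lam i else 0)%:E) -> uniq J ->
  (\int[P]_w ((\sum_(k <- J) Z k w * a k) ^+ 2)%:E =
    (\sum_(k <- J) lam k * a k ^+ 2)%:E)%E.
Proof.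
move=> mZ cov uJ.
(* A finite value of the extended integral already forces integrability. *)
have iZ i j : P.-integrable setT (fun w => (Z i w * Z j w)%:E).
  have mij : measurable_fun setT (fun w => Z i w * Z j w).
    exact: measurable_funM.
  apply/integrableP; split; first exact/measurable_EFinP.
  by rewrite integral_fin_num_abs// cov.
under eq_integral.
  move=> w _; rewrite (_ : (_ ^+ 2)%:E = (\sum_(i <- J) \sum_(j <- J)
      (a i * a j)%:E * (Z i w * Z j w)%:E)%E); last first.
    rewrite expr2 mulr_suml -sumEFin; apply: eq_bigr => i _.
    rewrite mulr_sumr -sumEFin; apply: eq_bigr => j _.
    by rewrite -EFinM; congr EFin; ring.
  over.
have iaZ i j :
    P.-integrable setT (fun w => (a i * a j)%:E * (Z i w * Z j w)%:E)%E.
  exact: integrableZl.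
rewrite integral_sum//; last by move=> i; exact: integrable_sum.
rewrite -sumEFin; apply: eq_big_seq => i iJ.
rewrite integral_sum// (bigD1_seq i)//= big1_seq ?adde0; last first.
  move=> j /andP[ji _]; rewrite integralZl// cov.
  by rewrite eq_sym (negbTE ji) mule0.
by rewrite integralZl// cov eqxx -EFinM; congr EFin; ring.
Qed.

(* Convexity gives [expR (min x m) <= expR y + expR m * |x - y|], so truncating
   the exponent at [m] makes the passage to the limit elementary; monotone
   convergence then removes the truncation. *)
Lemma integral_expR_le_L2_limit (X0 : T -> R) (C : R) :
  measurable_fun setT X0 ->
  (forall eta : R, 0 < eta -> exists U : T -> R, [/\ measurable_fun setT U,
    (\int[P]_w ((U w - X0 w) ^+ 2)%:E <= eta%:E)%E &
    (\int[P]_w (expR (U w))%:E <= C%:E)%E]) ->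
  (\int[P]_w (expR (X0 w))%:E <= C%:E)%E.
Proof.
move=> mX approx.
pose f (n : nat) w : R := expR (Num.min (X0 w) n%:R).
have mf n : measurable_fun setT (f n).
  by apply: measurableT_comp => //; exact: measurable_minr.
have f0 n w : 0 <= f n w by exact: expR_ge0.
have fC n : (\int[P]_w (f n w)%:E <= C%:E)%E.
  apply/lee_addgt0Pr => r r0.
  pose E : R := expR n%:R.
  have E0 : 0 < E by exact: expR_gt0.
  (* Chosen so that [E * del = r / 2]. With mean-square distance at most [r * del / (2 * E)], the
     term weighted by [E / del] also contributes at most [r / 2]. *)
  pose del : R := r / (2 * E).
  have del0 : 0 < del by rewrite divr_gt0// mulr_gt0.
  have eta0 : 0 < r * del / (2 * E) by rewrite divr_gt0// mulr_gt0.
  have [U [mU UX UC]] := approx _ eta0.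
  have q0 : 0 <= E / del by rewrite divr_ge0// ltW.
  have mUX : measurable_fun setT (fun w => (U w - X0 w) ^+ 2).
    by apply: measurable_funX; exact: measurable_funB.
  have -> : (C%:E + r%:E = (1 * C + 1 * (r / 2 * 1 + E / del *
      (r * del / (2 * E))))%:E)%E.
    rewrite -EFinD; congr EFin; field.
    by rewrite gt_eqF//= gt_eqF.
  have r20 : 0 <= r / 2 by rewrite ltW// divr_gt0.
  apply: (@integral_le_comb2 _ (fun w => expR (U w))
    (fun w => r / 2 * 1 + E / del * (U w - X0 w) ^+ 2)) => //.
  - exact: measurableT_comp.
  - by apply: measurable_funD => //; exact: measurable_funM.
  - by move=> w; rewrite addr_ge0// mulr_ge0 ?sqr_ge0// ltW// divr_gt0.
  - move=> w; rewrite !mul1r mulr1.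
    set y := U w; set x := X0 w; set u := Num.min x n%:R.
    have ux : u <= x by rewrite ge_min lexx.
    have un : u <= n%:R by rewrite ge_min lexx orbT.
    have Eu : expR u <= E by rewrite ler_expR.
    have eu0 : 0 < expR u := expR_gt0 u.
    have step1 : expR u * (1 + (y - x)) <= expR y.
      have -> : expR y = expR u * expR (y - u) by rewrite -expRD addrC subrK.
      rewrite ler_pM2l//.
      by apply: le_trans (expR_ge1Dx _); lra.
    have step2 : expR u * (x - y) <= E * `|y - x|.
      apply: (@le_trans _ _ (expR u * `|y - x|)).
        by rewrite ler_pM2l// distrC ler_norm.
      by rewrite ler_wpM2r.
    (* Young's inequality in the form [|z| <= del + z ^+ 2 / del], multiplied by [E]. *)
    have step3 : E * `|y - x| <= r / 2 + E / del * (y - x) ^+ 2.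
      have -> : r / 2 = E * del by rewrite /del; field; rewrite gt_eqF.
      rewrite -mulrA -mulrDr ler_pM2l//.
      rewrite -(ler_pM2l del0) mulrDr mulVKf ?gt_eqF//.
      rewrite -real_normK ?num_real//.
      by have := normr_ge0 (y - x); nra.
    rewrite /f -/x -/u; lra.
  - apply: (@integral_le_comb2 _ (fun=> 1)
      (fun w => (U w - X0 w) ^+ 2)) => //.
    + by apply: measurable_funD => //; exact: measurable_funM.
    + by move=> w; rewrite addr_ge0// mulr_ge0 ?sqr_ge0.
    + by move=> w; exact: sqr_ge0.
    + rewrite -[leLHS]/(\int[P]_w (cst 1%E w))%E integral_cst// mul1e.
      by rewrite -(@probability_setT _ _ _ P).
have cvgf w : (f n w)%:E @[n --> \oo] --> (expR (X0 w))%:E.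
  apply: cvg_near_cst; near=> n; congr (expR _)%:E; apply/min_idPl.
  by near: n; exact: nbhs_infty_ger.
have ndf w : {homo (fun n => (f n w)%:E) : m n / (m <= n)%N >-> (m <= n)%E}.
  by move=> m n mn; rewrite lee_fin ler_expR le_min2// ler_nat.
rewrite (_ : (\int[P]_w _)%E =
    (\int[P]_w limn (fun n => (f n w)%:E))%E); last first.
  by apply: eq_integral => w _; apply/esym/cvg_lim.
rewrite monotone_convergence//.
- apply: lime_le; last by near=> n.
  apply: ereal_nondecreasing_is_cvgn => m n mn.
  apply: ge0_le_integral => //.
  + by move=> w _; rewrite lee_fin.
  + exact/measurable_EFinP.
  + exact/measurable_EFinP.
  + by move=> w _; exact: ndf.
- by move=> n; exact/measurable_EFinP.
- by move=> n w _; rewrite lee_fin.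
Unshelve. all: by end_near. Qed.

End moments.

(** * Elementary inequalities for the exponential *)

Section scalar_bounds.
Context {R : realType}.

(** For [b <= a], the tangent line at [a] gives [expR a - expR b <= (a - b) * expR a]; adding the
    nonnegative [(a - b) * expR b] makes the bound symmetric. *)
Lemma normr_expRB_le (a b : R) :
  `|expR a - expR b| <= `|a - b| * (expR a + expR b).
Proof.
wlog ba : a b / b <= a => [th|].
  have [/th//|/ltW/th] := leP b a.
  by rewrite distrC (distrC b) (addrC (expR b)).
rewrite !ger0_norm ?subr_ge0 ?ler_expR//.
have : expR a * (1 + (b - a)) <= expR b.
  have -> : expR b = expR a * expR (b - a) by rewrite -expRD addrC subrK.
  by rewrite ler_pM2l ?expR_gt0// expR_ge1Dx.
have : 0 <= (a - b) * expR b by rewrite mulr_ge0 ?subr_ge0// expR_ge0.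
lra.
Qed.

(** For [u >= 0], raise [u / 4 <= expR (u / 4)] to the fourth power; 256 is [4 ^+ 4]. The second
    exponential serves negative [u]. *)
Lemma exprn4_le_expR (u : R) : u ^+ 4 <= 256 * expR u + 256 * expR (- u).
Proof.
wlog u0 : u / 0 <= u => [th|].
  have [/th//|/ltW u0] := leP 0 u.
  have := th (- u); rewrite oppr_ge0 opprK addrC => /(_ u0).
  by rewrite -[(- u) ^+ 4]/((- u) ^+ (2 * 2)) exprM sqrrN -exprM.
have -> : expR u = expR (u / 4) ^+ 4.
  by rewrite -expRM_natl; congr expR; field.
have h : u / 4 <= expR (u / 4) by apply: le_trans (expR_ge1Dx _); lra.
have : (u / 4) ^+ 4 <= expR (u / 4) ^+ 4.
  by rewrite lerXn2r// nnegrE ?expR_ge0 ?divr_ge0.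
have := expR_ge0 (- u).
rewrite expr_div_n; lra.
Qed.

(** With [u = (x - y) / r], [A = expR (c * x)] and [B = expR (c * y)], the previous difference bound
    leaves [u ^+ 2 * (A + B) ^+ 2]. This is at most [2 * u ^+ 2 * (A ^+ 2 + B ^+ 2)], and AM-GM on
    each product gives [2 * u ^+ 4 + A ^+ 4 + B ^+ 4]. The scale [r] will be [eps]. *)
Lemma sqr_expRB_le (c x y r : R) : 0 < r ->
  (expR (c * x) - expR (c * y)) ^+ 2 <= c ^+ 2 * r ^+ 2 *
    (2 * ((x - y) / r) ^+ 4 + 1 * (expR (4 * c * x) + expR (4 * c * y))).
Proof.
move=> r0; set A := expR (c * x); set B := expR (c * y).
have eA : expR (4 * c * x) = A ^+ 4.
  by rewrite -expRM_natl; congr expR; ring.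
have eB : expR (4 * c * y) = B ^+ 4.
  by rewrite -expRM_natl; congr expR; ring.
rewrite eA eB; set u := (x - y) / r.
have xyE : x - y = r * u by rewrite /u mulrC divfK// gt_eqF.
have h1 : (A - B) ^+ 2 <= (c * (r * u)) ^+ 2 * (A + B) ^+ 2.
  rewrite -xyE mulrBr -real_normK ?num_real//.
  rewrite -[(c * x - c * y) ^+ 2]real_normK ?num_real//.
  rewrite -exprMn lerXn2r// ?nnegrE ?normr_ge0//.
    by rewrite mulr_ge0// addr_ge0 ?expR_ge0.
  exact: normr_expRB_le.
apply: (le_trans h1).
have -> : (c * (r * u)) ^+ 2 * (A + B) ^+ 2 =
  c ^+ 2 * r ^+ 2 * (u ^+ 2 * (A + B) ^+ 2) by ring.
rewrite ler_wpM2l//; first by rewrite mulr_ge0// sqr_ge0.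
have := sqr_ge0 (u ^+ 2 - A ^+ 2); have := sqr_ge0 (u ^+ 2 - B ^+ 2).
have : 0 <= u ^+ 2 * (A - B) ^+ 2 by rewrite mulr_ge0 ?sqr_ge0.
nra.
Qed.

(** The right-hand side is symmetric in [x] and [y], so the one-sided bound controls the absolute
    difference, and it vanishes as [y] tends to [x]. Continuity is what makes each [g t]
    measurable. *)
Lemma continuous_of_max_expR_lip (f : R -> R) (c K : R) :
  (forall x y, f x - f y <=
    Num.max `|expR (c * x) - expR (c * y)| (K * `|x - y|)) ->
  continuous f.
Proof.
move=> fle x.
pose m y : R := Num.max `|expR (c * y) - expR (c * x)| (K * `|y - x|).
have fm y : `|f y - f x| <= m y.
  rewrite ler_norml fle andbT lerNl opprB.
  by apply: le_trans (fle _ _) _; rewrite distrC (distrC x).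
have m0 : m y @[y --> x] --> (0 : R).
  have -> : (0 : R) = m x by rewrite /m !subrr normr0 mulr0 maxxx.
  apply: (@continuous_max R R (fun y => `|expR (c * y) - expR (c * x)|)
    (fun y => K * `|y - x|)).
    apply: cvg_norm; apply: cvgB; last exact: cvg_cst.
    apply: continuous_comp; last exact: continuous_expR.
    by apply: cvgM; [exact: cvg_cst|exact: cvg_id].
  apply: cvgM; first exact: cvg_cst.
  by apply: cvg_norm; apply: cvgB; [exact: cvg_id|exact: cvg_cst].
apply/cvgrPdist_le => e e0; near=> y.
rewrite distrC (le_trans (fm y))//.
have : `|0 - m y| <= e by near: y; move/cvgrPdist_le : m0; exact.
by rewrite sub0r normrN => /(le_trans (ler_norm _)).
Unshelve. all: by end_near. Qed.

End scalar_bounds.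

(** * Sub-Gaussian bounds for the expansion at a fixed time *)

Section karhunen_loeve.
Context {R : realType} {d : measure_display} {T : measurableType d}.
Variables (P : probability T R) (X : R -> T -> R) (Z : nat -> T -> R).
Variables (e : nat -> R -> R) (lam : nat -> R) (t : R).
Hypothesis mX : measurable_fun setT (X t).
Hypothesis lam_ge0 : forall k, 0 <= lam k.
Hypothesis covZ : forall i j,
  (\int[P]_w (Z i w * Z j w)%:E)%E = (if i == j then lam i else 0)%:E.
Hypothesis KL : forall eta : R, 0 < eta -> exists N : nat,
  forall n : nat, (N <= n)%N -> (trunc_err P X Z e n t <= eta%:E)%E.
Hypothesis indepZ : mutually_independent P Z.
Hypothesis subgZ : forall k, subgaussian P (Z k) 0 (Num.sqrt (lam k)).

Let mZ k : measurable_fun setT (Z k). Proof. by case: indepZ. Qed.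

Lemma measurable_KLtrunc n : measurable_fun setT (KLtrunc Z e n t).
Proof. by apply: measurable_sum => k; exact: measurable_funM. Qed.

Lemma KLtruncB L n w : (L <= n)%N ->
  KLtrunc Z e n t w - KLtrunc Z e L t w = \sum_(L <= k < n) Z k w * e k t.
Proof.
move=> Ln; rewrite /KLtrunc -!(big_mkord xpredT (fun k => Z k w * e k t)).
by rewrite (big_cat_nat (leq0n L) Ln)/= addrC addrK.
Qed.

(** The sum is the second moment of a difference of two truncations. For large [m] both the
    truncation at [m] and the one at [L] are within [v] of [X t] in mean square, and [(a - b) ^+ 2
    <= 2 * (a - x) ^+ 2 + 2 * (b - x) ^+ 2] gives the factor 4. *)
Lemma KL_variance_le L (v : R) : 0 < v -> (trunc_err P X Z e L t <= v%:E)%E ->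
  forall n, \sum_(L <= k < n) lam k * e k t ^+ 2 <= 4 * v.
Proof.
move=> v0 errL n; have [N HN] := KL v0.
(* The bound [m >= N] makes the truncation error small; [m >= n] enlarges the sum by nonnegative
   terms only. *)
pose m := maxn (maxn N L) n.
have Lm : (L <= m)%N by rewrite /m !leq_max leqnn orbT.
have nm : (n <= m)%N by rewrite /m leq_max leqnn orbT.
have term0 k : 0 <= lam k * e k t ^+ 2 by rewrite mulr_ge0// sqr_ge0.
apply: (@le_trans _ _ (\sum_(L <= k < m) lam k * e k t ^+ 2)).
  have [Ln|nL] := leqP L n; last by rewrite big_geq 1?ltnW// sumr_ge0.
  by rewrite (big_cat_nat Ln nm)/= lerDl sumr_ge0.
rewrite -lee_fin -(integral_sqr_sum (P := P) (Z := Z) (fun k => e k t))//;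
  last exact: iota_uniq.
rewrite (_ : 4 * v = 2 * v + 2 * v); last by ring.
apply: (@integral_le_comb2 _ _ _ P _
  (fun w => (KLtrunc Z e L t w - X t w) ^+ 2)
  (fun w => (KLtrunc Z e m t w - X t w) ^+ 2)) => //.
- apply: measurable_funX; apply: measurable_sum => k; exact: measurable_funM.
- apply: measurable_funX; apply: measurable_funB => //;
    exact: measurable_KLtrunc.
- apply: measurable_funX; apply: measurable_funB => //;
    exact: measurable_KLtrunc.
- by move=> w; exact: sqr_ge0.
- by move=> w; exact: sqr_ge0.
- by move=> w; exact: sqr_ge0.
- move=> w; rewrite -KLtruncB//.
  set a := KLtrunc Z e m t w; set b := KLtrunc Z e L t w.
  have := sqr_ge0 ((a - X t w) + (b - X t w)); nra.
- by apply: HN; rewrite /m !leq_max leqnn.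
Qed.

(** The residual is the mean-square limit of the blocks from [L] to [n]. Each block has variance at
    most [4 * v], hence exponent [theta ^+ 2 / 2 * (4 * v)], and [integral_expR_le_L2_limit] carries
    the bound to the limit. *)
Lemma KL_residual_mgf_le L (v theta : R) : 0 < v ->
  (trunc_err P X Z e L t <= v%:E)%E ->
  (\int[P]_w (expR (theta * (X t w - KLtrunc Z e L t w)))%:E <=
    (expR (2 * theta ^+ 2 * v))%:E)%E.
Proof.
move=> v0 errL; apply: integral_expR_le_L2_limit.
  apply: measurable_funM => //; apply: measurable_funB => //.
  exact: measurable_KLtrunc.
move=> eta eta0.
(* Adding 1 keeps the divisor positive when [theta] is 0, while [theta ^+ 2] times the quotient
   stays at most [eta]. *)
have th0 : 0 < theta ^+ 2 + 1 by rewrite ltr_wpDl// sqr_ge0.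
have [N HN] := KL (divr_gt0 eta0 th0).
pose n := maxn N L.
have Ln : (L <= n)%N by rewrite leq_maxr.
have Nn : (N <= n)%N by rewrite leq_maxl.
exists (fun w => theta * (KLtrunc Z e n t w - KLtrunc Z e L t w)); split.
- apply: measurable_funM => //; apply: measurable_funB => //;
    exact: measurable_KLtrunc.
(* One dominating function is enough here; the zero function fills the second slot of
   [integral_le_comb2]. *)
- have -> : eta = (theta ^+ 2 + 1) * (eta / (theta ^+ 2 + 1)) + 0 * 0.
    by rewrite mulr0 addr0 mulrC divfK// gt_eqF.
  apply: (@integral_le_comb2 _ _ _ P _
    (fun w => (KLtrunc Z e n t w - X t w) ^+ 2) (fun=> 0)) => //.
  + apply: measurable_funX; apply: measurable_funB.
      apply: measurable_funM => //; apply: measurable_funB => //;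
        exact: measurable_KLtrunc.
    apply: measurable_funM => //; apply: measurable_funB => //;
      exact: measurable_KLtrunc.
  + apply: measurable_funX; apply: measurable_funB => //;
      exact: measurable_KLtrunc.
  + by move=> w; exact: sqr_ge0.
  + by move=> w; exact: sqr_ge0.
  + exact: ltW.
  + move=> w; have := sqr_ge0 (KLtrunc Z e n t w - X t w); nra.
  + exact: HN.
  + by rewrite integral0.
- under eq_integral do rewrite KLtruncB//.
  apply: le_trans (integral_expR_sum_le (fun k => e k t) theta indepZ lam_ge0
    subgZ _) _.
    exact: iota_uniq.
  rewrite lee_fin ler_expR.
  have := KL_variance_le v0 errL n.
  by have := sqr_ge0 theta; nra.
Qed.

(** Truncation at index 0 is the zero variable, so the second moment of [X t] is the truncation
    error at 0 and [KL_variance_le] bounds the variance of every partial sum. *)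
Lemma KLtrunc_mgf_le L (v theta : R) : 0 < v ->
  (\int[P]_w (X t w ^+ 2)%:E <= v%:E)%E ->
  (\int[P]_w (expR (theta * KLtrunc Z e L t w))%:E <=
    (expR (2 * theta ^+ 2 * v))%:E)%E.
Proof.
move=> v0 Xv.
have err0 : (trunc_err P X Z e 0 t <= v%:E)%E.
  apply: le_trans Xv; rewrite /trunc_err.
  by under eq_integral do rewrite /KLtrunc big_ord0 sub0r sqrrN.
under eq_integral do
  rewrite /KLtrunc -(big_mkord xpredT (fun k => Z k _ * e k t)).
apply: le_trans (integral_expR_sum_le (fun k => e k t) theta indepZ lam_ge0
  subgZ _) _.
  exact: iota_uniq.
rewrite lee_fin ler_expR.
have := KL_variance_le v0 err0 L.
by have := sqr_ge0 theta; nra.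
Qed.

(** The process is its own residual at truncation index 0. *)
Lemma KL_process_mgf_le (v theta : R) : 0 < v ->
  (\int[P]_w (X t w ^+ 2)%:E <= v%:E)%E ->
  (\int[P]_w (expR (theta * X t w))%:E <= (expR (2 * theta ^+ 2 * v))%:E)%E.
Proof.
move=> v0 Xv.
have err0 : (trunc_err P X Z e 0 t <= v%:E)%E.
  apply: le_trans Xv; rewrite /trunc_err.
  by under eq_integral do rewrite /KLtrunc big_ord0 sub0r sqrrN.
have := KL_residual_mgf_le theta v0 err0.
by under eq_integral do rewrite /KLtrunc big_ord0 subr0.
Qed.

(** Taking [theta] equal to plus or minus [1 / eps] cancels the variance bound [eps ^+ 2], leaving
    the exponent 2; [exprn4_le_expR] then bounds the fourth power by the two exponentials. *)
Lemma KL_residual_moment4_le L (eps : R) : 0 < eps ->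
  (trunc_err P X Z e L t <= (eps ^+ 2)%:E)%E ->
  (\int[P]_w (((X t w - KLtrunc Z e L t w) / eps) ^+ 4)%:E <=
    (512 * expR 2)%:E)%E.
Proof.
move=> eps0 errL.
have eps20 : 0 < eps ^+ 2 by rewrite exprn_gt0.
have mD : measurable_fun setT (fun w => X t w - KLtrunc Z e L t w).
  by apply: measurable_funB => //; exact: measurable_KLtrunc.
have -> : 512 * expR 2 = 256 * expR 2 + 256 * expR 2 :> R by ring.
have mgf (s : R) : s ^+ 2 = 1 -> (\int[P]_w
    (expR (s * ((X t w - KLtrunc Z e L t w) / eps)))%:E <= (expR 2)%:E)%E.
  move=> s1; have := KL_residual_mgf_le (s / eps) eps20 errL.
  rewrite expr_div_n s1 mul1r -mulrA mulVf ?gt_eqF// mulr1.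
  by under eq_integral do rewrite -mulrA [eps^-1 * _]mulrC.
apply: (@integral_le_comb2 _ _ _ P _
  (fun w => expR ((X t w - KLtrunc Z e L t w) / eps))
  (fun w => expR (- ((X t w - KLtrunc Z e L t w) / eps)))) => //.
- by apply: measurable_funX; exact: measurable_funM.
- by apply: measurableT_comp => //; exact: measurable_funM.
- apply: measurableT_comp => //; apply: measurableT_comp => //.
  exact: measurable_funM.
- by move=> w; rewrite (exprM _ 2 2) sqr_ge0.
- by move=> w; exact: exprn4_le_expR.
- have := mgf 1; rewrite expr1n => /(_ erefl).
  by under eq_integral do rewrite mul1r.
- have := mgf (- 1); rewrite sqrrN expr1n => /(_ erefl).
  by under eq_integral do rewrite mulN1r.
Qed.

End karhunen_loeve.

(** * Uniform variance bound and the mean-square estimate *)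

(** A continuous image of the compact square is bounded, and the diagonal of the covariance is the
    second moment. This bound makes the final constant independent of [t]. *)
Lemma covariance_diag_bounded (R : realType) (d : measure_display)
    (T : measurableType d) (P : probability T R) (X : R -> T -> R) :
  (forall t, I01 t -> P.-integrable setT (fun w => (X t w ^+ 2)%:E)) ->
  {within I01 `*` I01, continuous (fun p : R * R => covX P X p.1 p.2)} ->
  exists2 v : R, 0 < v &
    forall t, I01 t -> (\int[P]_w (X t w ^+ 2)%:E <= v%:E)%E.
Proof.
move=> sqX covc.
have cI : compact (I01 `*` I01 : set (R * R)).
  by apply: compact_setX; exact: segment_compact.
have /compact_bounded/pinfty_ex_gt0[v v0 vle] := continuous_compact covc cI.
exists v => // t It.
have -> : (\int[P]_w (X t w ^+ 2)%:E = (covX P X t t)%:E)%E.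
  rewrite /covX; under [in RHS]eq_integral do rewrite -expr2.
  by rewrite fineK//; exact: integrable_fin_num (sqX _ It).
rewrite lee_fin; apply: le_trans (ler_norm _) _.
by apply: vle; exists (t, t).
Qed.

Unset Implicit Arguments.

Theorem theorem5 (R : realType) (d : measure_display) (T : measurableType d)
  (P : probability T R) (X : R -> T -> R)
  (HXmeas : forall t, I01 t -> measurable_fun setT (X t))
  (HXsq : forall t, I01 t -> P.-integrable setT (fun w => (X t w ^+ 2)%:E))
  (HXint : forall t, I01 t -> P.-integrable setT (fun w => (X t w)%:E))
  (HXcent : forall t, I01 t -> (\int[P]_w (X t w)%:E = 0)%E)
  (Hcov : {within I01 `*` I01, continuous (fun p : R * R => covX P X p.1 p.2)})
  (e : nat -> R -> R) (lam : nat -> R)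
  (He_meas : forall k, measurable_fun I01 (e k))
  (He_orth : forall i j,
     (\int[lebesgue_measure]_(x in I01) (e i x * e j x)%:E)%E = ((i == j)%:R)%:E)
  (He_eig : forall k t, I01 t ->
     Rintegral lebesgue_measure I01 (fun s => covX P X s t * e k s) = lam k * e k t)
  (Hlam_ge0 : forall k, 0 <= lam k)
  (Hlam_decr : forall k, lam k.+1 <= lam k)
  (Z : nat -> T -> R)
  (HZdef : forall k, {ae P, forall w,
     Z k w = Rintegral lebesgue_measure I01 (fun t => X t w * e k t)})
  (HZcov : forall i j,
     (\int[P]_w (Z i w * Z j w)%:E)%E = (if i == j then lam i else 0)%:E)
  (HKL : forall eta : R, 0 < eta -> exists N : nat, forall n : nat, (N <= n)%N ->
     forall t, I01 t -> (trunc_err P X Z e n t <= eta%:E)%E)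
  (Hindep : mutually_independent P Z)
  (Hsubg : forall k, subgaussian P (Z k) 0 (Num.sqrt (lam k)))
  (cg Kg : R) (HKg : 0 <= Kg) (g : R -> R -> R)
  (Hg : forall t, I01 t -> forall x y : R,
     g t x - g t y <= Num.max `|expR (cg * x) - expR (cg * y)| (Kg * `|x - y|)) :
  exists C2 : R, forall (t eps : R) (L : nat),
    I01 t -> 0 < eps -> eps <= 1 -> is_trunc_index P X Z e eps L ->
    (\int[P]_w ((g t (X t w) - g t (KLtrunc Z e L t w)) ^+ 2)%:E
       <= (C2 * eps ^+ 2)%:E)%E.
Proof.
have [v v0 Xv] := covariance_diag_bounded HXsq Hcov.
(* [M] bounds the exponential moments at [theta = 4 * cg] of both the process and its truncation.
   [C] adds twice the scaled fourth moment of the residual to these two bounds, in the shape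
   produced by nested uses of [integral_le_comb2]. *)
pose M : R := expR (2 * (4 * cg) ^+ 2 * v).
pose C : R := 2 * (512 * expR 2) + 1 * (1 * M + 1 * M).
exists (Kg ^+ 2 * 1 + cg ^+ 2 * C) => t eps L It eps0 _ [errL _].
have KLt eta : 0 < eta -> exists N : nat, forall n : nat, (N <= n)%N ->
    (trunc_err P X Z e n t <= eta%:E)%E.
  by move=> /HKL[N HN]; exists N => n /HN; apply.
have mX := HXmeas _ It.
have mY := measurable_KLtrunc e t Hindep L.
have mgt : measurable_fun setT (g t).
  apply: continuous_measurable_fun.
  exact: continuous_of_max_expR_lip (Hg _ It).
(* The residual in units of [eps], whose fourth moment is bounded by an absolute constant. *)
pose U w := (X t w - KLtrunc Z e L t w) / eps.
have mU : measurable_fun setT U.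
  by apply: measurable_funM => //; exact: measurable_funB.
have mexp (c : R) (V : T -> R) : measurable_fun setT V ->
    measurable_fun setT (fun w => expR (c * V w)).
  by move=> mV; apply: measurableT_comp => //; exact: measurable_funM.
have H0 w : 0 <= 2 * U w ^+ 4 + 1 * (expR (4 * cg * X t w) +
    expR (4 * cg * KLtrunc Z e L t w)).
  apply: addr_ge0; first by rewrite mulr_ge0// (exprM _ 2 2) sqr_ge0.
  by rewrite mul1r addr_ge0 ?expR_ge0.
have -> : (Kg ^+ 2 * 1 + cg ^+ 2 * C) * eps ^+ 2 =
    Kg ^+ 2 * (eps ^+ 2) + cg ^+ 2 * eps ^+ 2 * C by ring.
apply: (@integral_le_comb2 _ _ _ P _
  (fun w => (KLtrunc Z e L t w - X t w) ^+ 2)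
  (fun w => 2 * U w ^+ 4 + 1 * (expR (4 * cg * X t w) +
     expR (4 * cg * KLtrunc Z e L t w)))) => //.
- by apply: measurable_funX; apply: measurable_funB; exact: measurableT_comp.
- by apply: measurable_funX; exact: measurable_funB.
- apply: measurable_funD.
    by apply: measurable_funM => //; exact: measurable_funX.
  by apply: measurable_funM => //; apply: measurable_funD; exact: mexp.
- by move=> w; exact: sqr_ge0.
- by move=> w; exact: sqr_ge0.
- by rewrite mulr_ge0 ?sqr_ge0.
- by rewrite mulr_ge0 ?sqr_ge0.
- move=> w; set x := X t w; set y := KLtrunc Z e L t w.
  (* The squared maximum is at most the sum of the squares of its two arguments: the Lipschitz one
     is paid by the truncation error, the exponential one by [sqr_expRB_le] with [r = eps]. *)
  apply: le_trans (_ : _ <= Kg ^+ 2 * (y - x) ^+ 2 +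
    (expR (cg * x) - expR (cg * y)) ^+ 2) _.
    pose m : R := Num.max `|expR (cg * x) - expR (cg * y)| (Kg * `|x - y|).
    have gm : `|g t x - g t y| <= m.
      rewrite ler_norml Hg// andbT lerNl opprB.
      by apply: le_trans (Hg _ It _ _) _; rewrite distrC (distrC y).
    have m0 : 0 <= m by exact: le_trans gm.
    apply: (@le_trans _ _ (m ^+ 2)).
      by rewrite -real_normK ?num_real// lerXn2r// nnegrE.
    rewrite /m maxEle; case: ifP => _.
      by rewrite exprMn real_normK ?num_real// -[(x - y) ^+ 2]sqrrN opprB lerDl
        sqr_ge0.
    by rewrite real_normK ?num_real// lerDr mulr_ge0 ?sqr_ge0.
  by rewrite lerD2l; exact: sqr_expRB_le.
- exact: errL.
- apply: (@integral_le_comb2 _ _ _ P _ (fun w => U w ^+ 4)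
    (fun w => expR (4 * cg * X t w) + expR (4 * cg * KLtrunc Z e L t w))) => //.
  + apply: measurable_funD.
      by apply: measurable_funM => //; exact: measurable_funX.
    by apply: measurable_funM => //; apply: measurable_funD; exact: mexp.
  + exact: measurable_funX.
  + by apply: measurable_funD; exact: mexp.
  + by move=> w; rewrite (exprM _ 2 2) sqr_ge0.
  + exact: (KL_residual_moment4_le mX Hlam_ge0 HZcov KLt Hindep Hsubg eps0
      (errL _ It)).
  + apply: (@integral_le_comb2 _ _ _ P _ (fun w => expR (4 * cg * X t w))
      (fun w => expR (4 * cg * KLtrunc Z e L t w))) => //.
    * by apply: measurable_funD; exact: mexp.
    * exact: mexp.
    * exact: mexp.
    * by move=> w; rewrite !mul1r.
    * exact: (KL_process_mgf_le mX Hlam_ge0 HZcov KLt Hindep Hsubg _ v0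
        (Xv _ It)).
    * exact: (KLtrunc_mgf_le mX Hlam_ge0 HZcov KLt Hindep Hsubg _ _ v0
        (Xv _ It)).
Qed.
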